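(* In the noncommutative differential calculus on quantum Minkowski space $\mathcal X$, let $f=f(x_{3\setminus0},x_-)$ be a linear combination of ordered monomials $(x_{3\setminus0})^k(x_-)^l$. Then $$\nabla f(x_{3\setminus0},x_-)=\frac{\partial_{q^2}f}{\partial_{q^2}x_{3\setminus0}}\,\nabla x_{3\setminus0}+\frac{\partial_{q^2}f}{\partial_{q^2}x_-}\,\nabla x_-\,.$$ Likewise, let $f=f(x_+,x_{3\setminus0})$ be a linear combination of ordered monomials $(x_+)^k(x_{3\setminus0})^l$. Then $$\nabla f(x_+,x_{3\setminus0})=\frac{\partial_{q^2}f}{\partial_{q^2}x_+}\,\nabla x_++\frac{\partial_{q^2}f}{\partial_{q^2}x_{3\setminus0}}\,\nabla x_{3\setminus0}\,.$$ Here $\frac{\partial_{q^2}f}{\partial_{q^2}x_\alpha}$ are the partial Jackson derivatives taken with respect to the indicated ordering.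
   Context: Fix a real $q>0$, $q\neq1$. Put $\lambda=q-q^{-1}$, $[n]=\frac{q^n-q^{-n}}{q-q^{-1}}$, $(n)_{q^2}=\frac{q^{2n}-1}{q^2-1}$. Algebra. $\mathcal X$ (quantum Minkowski space) is the unital complex algebra generated by $x_0,x_-,x_+,x_3$ with relations: $x_0$ commutes with all generators; $q^{-1}x_-x_3-qx_3x_-=-\lambda x_-x_0$; $q^{-1}x_3x_+-qx_+x_3=-\lambda x_+x_0$; $x_-x_+-x_+x_--\lambda x_3x_3=-\lambda x_3x_0$. It is graded by degree. Put $x_{3\setminus0}:=x_3-x_0$. Calculus. Let $e_0,e_-,e_+,e_3$ be the standard basis of $\mathbb{C}^4$; column vectors in $\mathcal X^4$ are indexed by $\mu\in\{0,-,+,3\}$. Put $e_{--}=[2]^{1/2}e_-$, $e_{-+}=q^{1/2}(e_3-e_0)$, $e_{+-}=q^{-1/2}e_3+q^{3/2}e_0$, $e_{++}=[2]^{1/2}e_+$ (spinor basis). Define $2\times2$ matrices over $\mathcal X$ $$B_{x_0}=\begin{pmatrix}\frac{[4]}{[2]^2}x_0+\frac{\lambda}{q[2]}x_3&q^{-1/2}\lambda[2]^{-1/2}x_+\\-q^{1/2}\lambda[2]^{-1/2}x_-&\frac{[4]}{[2]^2}x_0-\frac{q\lambda}{[2]}x_3\end{pmatrix},\quad B_{x_-}=\begin{pmatrix}x_-&q^{-1/2}\lambda[2]^{-1/2}x_{3\setminus0}\\0&x_-\end{pmatrix},$$ $$B_{x_+}=\begin{pmatrix}x_+&0\\-q^{1/2}\lambda[2]^{-1/2}x_{3\setminus0}&x_+\end{pmatrix},\quad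 B_{x_{3\setminus0}}=\begin{pmatrix}q^{-1}x_{3\setminus0}&0\\0&qx_{3\setminus0}\end{pmatrix},\quad B_{x_3}=B_{x_{3\setminus0}}+B_{x_0},$$ and, as block matrices with respect to the ordered basis $(e_{--},e_{-+},e_{+-},e_{++})$, $$L_{x_0}=\begin{pmatrix}B_{x_0}&0\\0&B_{x_0}\end{pmatrix},\; L_{x_-}=\begin{pmatrix}qB_{x_-}&q^{-1/2}\lambda[2]^{1/2}B_{x_3}\\0&q^{-1}B_{x_-}\end{pmatrix},\; L_{x_+}=\begin{pmatrix}q^{-1}B_{x_+}&0\\0&qB_{x_+}\end{pmatrix},\; L_{x_{3\setminus0}}=\begin{pmatrix}B_{x_{3\setminus0}}&q^{-1/2}\lambda[2]^{1/2}B_{x_+}\\0&B_{x_{3\setminus0}}\end{pmatrix}.$$ These assignments extend to a unital algebra homomorphism $f\mapsto L_f$, $\mathcal X\to M_4(\mathcal X)$. Let $\Lambda:\mathcal X\to M_4(\mathcal X)$ be the algebra homomorphism with $\Lambda(f)=q^nL_f$ for $f$ homogeneous of degree $n$. The gradient $\nabla:\mathcal X\to\mathcal X^4$, with components $(\nabla f)^\mu=\partial^\mu\triangleright f$ (partial derivatives), is the unique linear map with $\nabla1=0$, $\nabla x_\alpha=e_\alpha$ ($\alpha\in\{0,-,+,3\}$) and $\nabla(fg)=(\nabla f)g+\Lambda(f)\nabla g$. In particular $\nabla x_{3\setminus0}=e_3-e_0$. Partial Jackson derivatives: for an ordered list $y_1,\dots,y_n$ of elements, $\frac{\partial_{q^2}}{\partial_{q^2}y_\alpha}\bigl(y_1^{k_1}\cdots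 y_n^{k_n}\bigr):=(k_\alpha)_{q^2}\,y_1^{k_1}\cdots y_\alpha^{k_\alpha-1}\cdots y_n^{k_n}$, extended linearly to linear combinations of monomials in this fixed order (they depend on the order chosen). *)

(* Defs.v *)
From HB Require Import structures.
From mathcomp Require Import all_boot all_order all_algebra.
From mathcomp Require Import generic_quotient ring_quotient.
From mathcomp Require Import boolp reals complex.
From mathcomp Require Import finmap monalg.

Set Implicit Arguments.
Unset Strict Implicit.
Unset Printing Implicit Defensive.

Import Order.TTheory GRing.Theory Num.Theory.
Local Open Scope ring_scope.
Local Open Scope quotient_scope.

(* Quotient of an algebra by the two-sided ideal generated by a list of
   elements.  The library provides the additive group of such a quotient, but
   its product only for commutative rings.  As the library's rings are
   nontrivial, properness of the ideal is bundled with the list. *)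
Section QuotientAlgebra.

Variables (K : comNzRingType) (F : algType K).

Definition ideal_comb (rels : seq F) (p : F) : Prop :=
  exists s : seq (F * F * F),
    all (fun t => t.1.2 \in rels) s /\ p = \sum_(t <- s) t.1.1 * t.1.2 * t.2.

Record relators := Relators {
  relators_seq :> seq F;
  relators_proper : ~ ideal_comb relators_seq 1
}.

Variable rels : relators.

Definition ideal_gen : {pred F} := [pred p | `[< ideal_comb rels p >]].

Lemma ideal_genP p : reflect (ideal_comb rels p) (p \in ideal_gen).
Proof. by rewrite inE; apply: asboolP. Qed.

Lemma ideal_gen_zmod : zmod_closed ideal_gen.
Proof.
split; first by apply/ideal_genP; exists [::]; rewrite big_nil.
move=> x y /ideal_genP[s [sr ->]] /ideal_genP[t [tr ->]]; apply/ideal_genP.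
exists (s ++ [seq (- u.1.1, u.1.2, u.2) | u <- t]); split.
  by rewrite all_cat sr all_map.
rewrite big_cat big_map /= -sumrN; congr (_ + _).
by apply: eq_bigr => u _; rewrite !mulNr.
Qed.
HB.instance Definition _ :=
  GRing.isZmodClosed.Build F ideal_gen ideal_gen_zmod.

Lemma ideal_genMl a x : x \in ideal_gen -> a * x \in ideal_gen.
Proof.
move=> /ideal_genP[s [sr ->]]; apply/ideal_genP.
exists [seq (a * u.1.1, u.1.2, u.2) | u <- s]; split; first by rewrite all_map.
by rewrite big_map mulr_sumr; apply: eq_bigr => u _; rewrite !mulrA.
Qed.

Lemma ideal_genMr a x : x \in ideal_gen -> x * a \in ideal_gen.
Proof.
move=> /ideal_genP[s [sr ->]]; apply/ideal_genP.
exists [seq (u.1.1, u.1.2, u.2 * a) | u <- s]; split; first by rewrite all_map.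
by rewrite big_map mulr_suml; apply: eq_bigr => u _; rewrite !mulrA.
Qed.

Definition quotalg := Quotient.quot ideal_gen.
HB.instance Definition _ := GRing.Zmodule.on quotalg.

Definition quotpi (p : F) : quotalg := \pi_(Quotient.quot ideal_gen) p.
Local Notation qrepr := (fun x : quotalg => repr (x : Quotient.quot ideal_gen)).

Definition quotalg_one : quotalg := quotpi 1.
Definition quotalg_mul (x y : quotalg) : quotalg := quotpi (qrepr x * qrepr y).
Definition quotalg_scale (c : K) (x : quotalg) : quotalg :=
  quotpi (c *: qrepr x).

Lemma qreprK (x : quotalg) : quotpi (qrepr x) = x.
Proof. exact: reprK. Qed.

Lemma quotpi_eqP (x y : F) : reflect (quotpi x = quotpi y) (x - y \in ideal_gen).
Proof. by rewrite Quotient.idealrBE; apply: eqP. Qed.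

Lemma qrepr_pi (x : F) : qrepr (quotpi x) - x \in ideal_gen.
Proof. by apply/quotpi_eqP; rewrite qreprK. Qed.

Lemma quotpiM x y : quotpi (x * y) = quotalg_mul (quotpi x) (quotpi y).
Proof.
apply/esym/quotpi_eqP; move: (qrepr_pi x) (qrepr_pi y) => /=.
set x' := repr _; set y' := repr _ => Ix Iy.
have -> : x' * y' - x * y = (x' - x) * y' + x * (y' - y).
  by rewrite mulrBl mulrBr addrA subrK.
by apply: rpredD; [apply: ideal_genMr | apply: ideal_genMl].
Qed.

Lemma quotpiZ c x : quotpi (c *: x) = quotalg_scale c (quotpi x).
Proof.
apply/esym/quotpi_eqP.
by rewrite -scalerBr -mulr_algl ideal_genMl // qrepr_pi.
Qed.

Lemma quotpiD x y : quotpi (x + y) = quotpi x + quotpi y.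
Proof. exact: Quotient.pi_add. Qed.

Fact quotalg_mulA : associative quotalg_mul.
Proof.
by move=> x y z; rewrite -[x]qreprK -[y]qreprK -[z]qreprK -!quotpiM mulrA.
Qed.
Fact quotalg_mul1 : left_id quotalg_one quotalg_mul.
Proof. by move=> x; rewrite -[x]qreprK -quotpiM mul1r. Qed.
Fact quotalg_mulr1 : right_id quotalg_one quotalg_mul.
Proof. by move=> x; rewrite -[x]qreprK -quotpiM mulr1. Qed.
Fact quotalg_mulDl : left_distributive quotalg_mul +%R.
Proof.
move=> x y z; rewrite -[x]qreprK -[y]qreprK -[z]qreprK.
by rewrite -quotpiD -!quotpiM -quotpiD mulrDl.
Qed.
Fact quotalg_mulDr : right_distributive quotalg_mul +%R.
Proof.
move=> x y z; rewrite -[x]qreprK -[y]qreprK -[z]qreprK.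
by rewrite -quotpiD -!quotpiM -quotpiD mulrDr.
Qed.
Fact quotalg_one_neq0 : quotalg_one != 0.
Proof.
have -> : (0 : quotalg) = quotpi 0 
  by apply: (addrI (quotpi 0)); rewrite -quotpiD !addr0.
by apply/eqP => /quotpi_eqP; rewrite subr0 => /ideal_genP/relators_proper.
Qed.
HB.instance Definition _ := GRing.Zmodule_isNzRing.Build quotalg
  quotalg_mulA quotalg_mul1 quotalg_mulr1 quotalg_mulDl quotalg_mulDr
  quotalg_one_neq0.

Fact quotalg_scaleA a b x :
  quotalg_scale a (quotalg_scale b x) = quotalg_scale (a * b) x.
Proof. by rewrite -[x]qreprK -!quotpiZ scalerA. Qed.
Fact quotalg_scale1 : left_id 1 quotalg_scale.
Proof. by move=> x; rewrite -[x]qreprK -quotpiZ scale1r. Qed.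
Fact quotalg_scaleDr : right_distributive quotalg_scale +%R.
Proof.
move=> a x y; rewrite -[x]qreprK -[y]qreprK.
by rewrite -quotpiD -!quotpiZ -quotpiD scalerDr.
Qed.
Fact quotalg_scaleDl x : {morph quotalg_scale^~ x : a b / a + b}.
Proof.
by move=> a b /=; rewrite -[x]qreprK -!quotpiZ scalerDl quotpiD.
Qed.
HB.instance Definition _ := GRing.Zmodule_isLmodule.Build K quotalg
  quotalg_scaleA quotalg_scale1 quotalg_scaleDr quotalg_scaleDl.

Fact quotalg_scaleAl c (x y : quotalg) : c *: (x * y) = (c *: x) * y.
Proof.
suff: quotalg_scale c (quotalg_mul x y) = quotalg_mul (quotalg_scale c x) y.
  by [].
rewrite -[x]qreprK -[y]qreprK.
by rewrite -quotpiM -!quotpiZ -quotpiM scalerAl.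
Qed.
HB.instance Definition _ :=
  GRing.Lmodule_isLalgebra.Build K quotalg quotalg_scaleAl.

Fact quotalg_scaleAr c (x y : quotalg) : c *: (x * y) = x * (c *: y).
Proof.
suff: quotalg_scale c (quotalg_mul x y) = quotalg_mul x (quotalg_scale c y).
  by [].
rewrite -[x]qreprK -[y]qreprK.
by rewrite -quotpiM -!quotpiZ -quotpiM scalerAr.
Qed.
HB.instance Definition _ :=
  GRing.Lalgebra_isAlgebra.Build K quotalg quotalg_scaleAr.

Fact quotpi_is_zmod_morphism : zmod_morphism quotpi.
Proof.
move=> x y; rewrite quotpiD -scaleN1r quotpiZ; congr (_ + _).
exact: scaleN1r.
Qed.
HB.instance Definition _ :=
  GRing.isZmodMorphism.Build F quotalg quotpi quotpi_is_zmod_morphism.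
Fact quotpi_is_monoid_morphism : monoid_morphism quotpi.
Proof. by split=> // x y; rewrite quotpiM. Qed.
HB.instance Definition _ :=
  GRing.isMonoidMorphism.Build F quotalg quotpi quotpi_is_monoid_morphism.
Fact quotpi_is_scalable : scalable quotpi.
Proof. by move=> c x; rewrite quotpiZ. Qed.
HB.instance Definition _ :=
  GRing.isScalable.Build K F quotalg *:%R quotpi quotpi_is_scalable.

Lemma quotpi_rel p : p \in (rels : seq F) -> quotpi p = 0.
Proof.
move=> pr; rewrite -(rmorph0 quotpi); apply/quotpi_eqP/ideal_genP.
exists [:: (1, p, 1)]; split; first by rewrite /= pr.
by rewrite big_seq1 /= mul1r mulr1 subr0.
Qed.

End QuotientAlgebra.

(* The index set {0, -, +, 3}, in this order. *)
Definition i0 : 'I_4 := @Ordinal 4 0 isT.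
Definition im : 'I_4 := @Ordinal 4 1 isT.
Definition ip : 'I_4 := @Ordinal 4 2 isT.
Definition i3 : 'I_4 := @Ordinal 4 3 isT.

(* The free unital algebra on the four generators. *)
Definition freeX (K : comNzRingType) := {malg K[{fmonom 'I_4}]}.
HB.instance Definition _ (K : comNzRingType) := GRing.Lalgebra.on (freeX K).

Lemma malg_scaleAr (K : comNzRingType) (M : monomType) c (x y : {malg K[M]}) :
  c *: (x * y) = x * (c *: y).
Proof.
have comC : c%:MP * x = x * c%:MP.
  apply/malgP => k; rewrite mul_malgC mcoeffZ malgM_def fgmulgU.
  rewrite raddf_sum [X in X@_k]monalgE raddf_sum mulr_sumr /=.
  by apply: eq_bigr => k' _; rewrite mulm1 !mcoeffU mulrnAr mulrC.
by rewrite -[LHS]mul_malgC -[X in _ = _ * X]mul_malgC !mulrA comC.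
Qed.
HB.instance Definition _ (K : comNzRingType) :=
  GRing.Lalgebra_isAlgebra.Build K (freeX K)
    (@malg_scaleAr K {fmonom 'I_4}).

Definition fgen (K : comNzRingType) (a : 'I_4) : freeX K := << fmu a >>.

(* The augmentation (constant coefficient); it kills the defining relations. *)
Section Augmentation.
Variable K : comNzRingType.
Implicit Types x y : freeX K.

Definition aug x : K := x@_(@mone {fmonom 'I_4}).

Lemma augD x y : aug (x + y) = aug x + aug y.
Proof. exact: mcoeffD. Qed.
Lemma augB x y : aug (x - y) = aug x - aug y.
Proof. exact: mcoeffB. Qed.
Lemma augM x y : aug (x * y) = aug x * aug y.
Proof. exact: (rmorphM (@mcoeff {fmonom 'I_4} K (@mone _))). Qed.
Lemma augZ c x : aug (c *: x) = c * aug x.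
Proof. exact: mcoeffZ. Qed.
Lemma aug1 : aug 1 = 1.
Proof. exact: (rmorph1 (@mcoeff {fmonom 'I_4} K (@mone _))). Qed.
Lemma aug0 : aug 0 = 0.
Proof. exact: mcoeff0. Qed.
Lemma aug_fgen a : aug (fgen K a) = 0.
Proof. by rewrite /aug /fgen mcoeffU1 fm1_eq1. Qed.

End Augmentation.

Section QuantumMinkowski.

Variables (R : realType) (q : R).

Definition lambda : R := q - q^-1.
Definition qnum (n : nat) : R := (q ^+ n - q ^- n) / (q - q^-1).
Definition qnum2 (n : nat) : R := (q ^+ (2 * n) - 1) / (q ^+ 2 - 1).

Local Notation "r *:r x" := ((r)%:C%C *: x) (at level 40).

(* Left-hand side minus right-hand side of each defining relation. *)
Definition rels_of (F : algType R[i]) (x0 xm xp x3 : F) : seq F :=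
  [:: x0 * xm - xm * x0;
      x0 * xp - xp * x0;
      x0 * x3 - x3 * x0;
      q^-1 *:r (xm * x3) - q *:r (x3 * xm) - (- lambda) *:r (xm * x0);
      q^-1 *:r (x3 * xp) - q *:r (xp * x3) - (- lambda) *:r (xp * x0);
      xm * xp - xp * xm - lambda *:r (x3 * x3) - (- lambda) *:r (x3 * x0)].

Lemma rels_of_ker (F : algType R[i]) (h : F -> R[i]) (x0 xm xp x3 : F) :
    (forall x y, h (x - y) = h x - h y) -> (forall x y, h (x * y) = h x * h y) ->
    (forall c x, h (c *: x) = c * h x) ->
    h x0 = 0 -> h xm = 0 -> h xp = 0 -> h x3 = 0 ->
  forall p, p \in rels_of x0 xm xp x3 -> h p = 0.
Proof.
move=> hB hM hZ h0 hm hp h3 p; rewrite !inE.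
by do 5?[case/predU1P => [->|]]; last move=> /eqP->;
  rewrite !(hB, hZ, hM) ?(h0, hm, hp, h3) !(mulr0, subr0).
Qed.

Lemma rels_of_map (F G : algType R[i]) (h : {lrmorphism F -> G}) (x0 xm xp x3 : F) :
  rels_of (h x0) (h xm) (h xp) (h x3) = map h (rels_of x0 xm xp x3).
Proof.
have hZ c x : h (c *: x) = c *: h x by exact: linearZZ.
have hB x y : h (x - y) = h x - h y by exact: rmorphB.
have hM x y : h (x * y) = h x * h y by exact: rmorphM.
by rewrite /rels_of [map _ _]/= !(hB, hZ, hM).
Qed.

Definition mink_rels : seq (freeX R[i]) :=
  rels_of (fgen R[i] i0) (fgen R[i] im) (fgen R[i] ip) (fgen R[i] i3).

Lemma mink_rels_proper : ~ ideal_comb mink_rels 1.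
Proof.
have rel0 p : p \in mink_rels -> aug p = 0.
  by apply: rels_of_ker;
    [exact: augB|exact: augM|exact: augZ| exact: aug_fgen..].
move=> [s [/allP sr /(congr1 (@aug _))]]; apply/eqP.
rewrite aug1 (big_morph _ (@augD _) (@aug0 _)) big_seq big1 ?oner_neq0 // => t.
by move=> /sr tr; rewrite !augM (rel0 _ tr) mulr0 mul0r.
Qed.

Definition minkX := quotalg (Relators mink_rels_proper).
HB.instance Definition _ := GRing.Algebra.on minkX.

Definition piX : freeX R[i] -> minkX := @quotpi _ _ _.

Definition xgen (a : 'I_4) : minkX := piX (fgen R[i] a).
Definition x0 := xgen i0.
Definition xm := xgen im.
Definition xp := xgen ip.
Definition x3 := xgen i3.
Definition x30 : minkX := x3 - x0.

Lemma minkX_rels p : p \in rels_of x0 xm xp x3 -> p = 0.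
Proof.
pose h : {lrmorphism freeX R[i] -> minkX} := @quotpi _ _ _.
rewrite (rels_of_map h) => /mapP[r r_rel ->].
exact: quotpi_rel.
Qed.

Definition homogeneous (n : nat) (f : minkX) : Prop :=
  exists p : freeX R[i],
    f = piX p /\ (forall m : {fmonom 'I_4}, m \in msupp p -> fdeg m = n).

Local Notation "r *:m M" :=
  (map_mx (fun y : minkX => (r)%:C%C *: y) M) (at level 40).

Local Notation "[2]" := (qnum 2).
Local Notation "[4]" := (qnum 4).
Local Notation sq := (Num.sqrt q).
Local Notation s2 := (Num.sqrt [2]).

Definition mx22 (a b c d : minkX) : 'M[minkX]_(1 + 1) :=
  block_mx a%:M b%:M c%:M d%:M.

Definition B0 : 'M[minkX]_(1 + 1) :=
  mx22 (([4] / [2] ^+ 2) *:r x0 + (lambda / (q * [2])) *:r x3)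
       ((sq^-1 * lambda * s2^-1) *:r xp)
       ((- (sq * lambda * s2^-1)) *:r xm)
       (([4] / [2] ^+ 2) *:r x0 - (q * lambda / [2]) *:r x3).
Definition Bm : 'M[minkX]_(1 + 1) :=
  mx22 xm ((sq^-1 * lambda * s2^-1) *:r x30) 0 xm.
Definition Bp : 'M[minkX]_(1 + 1) :=
  mx22 xp 0 ((- (sq * lambda * s2^-1)) *:r x30) xp.
Definition B30 : 'M[minkX]_(1 + 1) := mx22 (q^-1 *:r x30) 0 0 (q *:r x30).
Definition B3 : 'M[minkX]_(1 + 1) := B30 + B0.

(* The matrices of L on x_0, x_-, x_+ and x_3 - x_0, in the spinor basis. *)
Definition spinL0 : 'M[minkX]_((1 + 1) + (1 + 1)) := block_mx B0 0 0 B0.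
Definition spinLm : 'M[minkX]_((1 + 1) + (1 + 1)) :=
  block_mx (q *:m Bm) ((sq^-1 * lambda * s2) *:m B3) 0 (q^-1 *:m Bm).
Definition spinLp : 'M[minkX]_((1 + 1) + (1 + 1)) :=
  block_mx (q^-1 *:m Bp) 0 0 (q *:m Bp).
Definition spinL30 : 'M[minkX]_((1 + 1) + (1 + 1)) :=
  block_mx B30 ((sq^-1 * lambda * s2) *:m Bp) 0 B30.

Definition ebasis (A : nzRingType) (a : 'I_4) : 'cV[A]_4 := delta_mx a 0.

(* The columns are e_--, e_-+, e_+-, e_++, written in the basis
   e_0, e_-, e_+, e_3. *)
Definition spinor_basis : 'M[R[i]]_(4, (1 + 1) + (1 + 1)) :=
  let e := @ebasis R[i] in
  row_mx
    (row_mx (s2%:C%C *: e im)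
            (sq%:C%C *: (e i3 - e i0)))
    (row_mx (sq^-1%:C%C *: e i3 + (sq ^+ 3)%:C%C *: e i0)
            (s2%:C%C *: e ip)).

(* Change of coordinates of an X-linear endomorphism of X^4 from the spinor
   basis to e_0, e_-, e_+, e_3. *)
Definition from_spinor (M : 'M[minkX]_((1 + 1) + (1 + 1))) : 'M[minkX]_4 :=
  let P := spinor_basis : 'M[R[i]]_4 in
  map_mx (in_alg minkX) P *m M *m map_mx (in_alg minkX) (invmx P).

(* Unital complex algebra homomorphisms X -> M_4(X) and complex linear maps
   X -> X^4: a complex scalar c acts on matrices over X through c * 1. *)
Definition homM4 := {lrmorphism minkX -> 'M[minkX]_4 | in_alg minkX \; *:%R}.
Definition linV4 := {linear minkX -> 'cV[minkX]_4 | in_alg minkX \; *:%R}.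

Definition is_L (L : homM4) : Prop :=
  [/\ L x0 = from_spinor spinL0, L xm = from_spinor spinLm,
      L xp = from_spinor spinLp & L x30 = from_spinor spinL30].

Definition is_Lambda (L Lam : homM4) : Prop :=
  forall (n : nat) (f : minkX), homogeneous n f ->
    Lam f = (q ^+ n) *:m L f.

Definition is_gradient (Lam : homM4) (nabla : linV4) : Prop :=
  [/\ nabla 1 = 0,
      (forall a : 'I_4, nabla (xgen a) = ebasis minkX a)
    & (forall f g : minkX,
         nabla (f * g) = nabla f *m g%:M + Lam f *m nabla g)].

(* Formal linear combinations of exponent vectors k in N^n, standing for linear
   combinations of the ordered monomials y_1^k_1 ... y_n^k_n.  Jackson
   derivatives are defined on these, so that they make sense without linear
   independence of the ordered monomials in X. *)
Definition ordpoly (n : nat) := {malg R[i][{ffun 'I_n -> nat}]}.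

Section Jackson.

Variables (n : nat) (y : n.-tuple minkX).

Definition ordmon (k : {ffun 'I_n -> nat}) : minkX :=
  \prod_(i < n) tnth y i ^+ k i.

Definition ordeval (f : ordpoly n) : minkX :=
  \sum_(k <- msupp f) f@_k *: ordmon k.

(* When k_a = 0 the truncated exponent is irrelevant, since qnum2 0 = 0. *)
Definition jackson (a : 'I_n) (f : ordpoly n) : minkX :=
  \sum_(k <- msupp f)
    (f@_k * (qnum2 (k a))%:C%C) *: ordmon [ffun i => k i - (i == a)]%N.

End Jackson.

End QuantumMinkowski.

(* Main.v *)
Require Import Defs.
From mathcomp Require Import all_boot all_order all_algebra.
From mathcomp Require Import reals complex.
From mathcomp Require Import finmap monalg.
From mathcomp Require Import ring.

(* The gradients of the generators are eigenvectors of the Lambda's that occur: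
   Lambda(x_{3\0}), Lambda(x_-) and Lambda(x_+) act on nabla x_{3\0}, nabla x_-
   and nabla x_+ respectively as left multiplication by q^2 times the
   generator, while Lambda(x_{3\0}) acts on nabla x_-, and Lambda(x_+) on
   nabla x_{3\0}, as left multiplication by the generator itself.  All of this
   can be read off columns of the spinor matrices, because nabla x_{3\0},
   nabla x_- and nabla x_+ are multiples of e_{-+}, e_{--} and e_{++}.  The
   twisted Leibniz rule then turns powers into geometric sums (k)_{q^2}, and
   the first factor of an ordered monomial passes through the gradient of the
   second without any power of q. *)

Import Order.TTheory GRing.Theory Num.Theory.
Local Open Scope ring_scope.

(** As [A] is not commutative, left multiplication by [a] need not pass through a matrix; the second
    hypothesis turns it into right multiplication by a scalar matrix, which does. *)
Lemma conj_mx_eigencol (K : comUnitRingType) (A : nzRingType)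
    (f : {rmorphism K -> A}) n (P : 'M[K]_n) (M : 'M[A]_n)
    (w : 'cV[K]_n) (a : A) :
    P \in unitmx ->
    (forall m (u : 'cV_m), map_mx f u *m a%:M = a *: map_mx f u) ->
    M *m map_mx f w = a *: map_mx f w ->
  map_mx f P *m M *m map_mx f (invmx P) *m map_mx f (P *m w)
    = a *: map_mx f (P *m w).
Proof.
move=> Pu fa Mw; rewrite -!mulmxA -map_mxM mulKmx // Mw map_mxM -fa mulmxA.
by rewrite -map_mxM fa.
Qed.

(** The height is [(1 + 1) + (1 + 1)] so that block products apply without casts. *)
Definition col4 {A : nzRingType} (a b c d : A) : 'cV[A]_((1 + 1) + (1 + 1)) :=
  col_mx (col_mx a%:M b%:M) (col_mx c%:M d%:M).

Lemma block22_mul (A : nzRingType) (a b c d x y : A) :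
  block_mx a%:M b%:M c%:M d%:M *m col_mx x%:M y%:M
  = col_mx (a * x + b * y)%:M (c * x + d * y)%:M :> 'cV[A]_(1 + 1).
Proof. by rewrite mul_block_col !raddfD /= !scalar_mxM. Qed.

Lemma map_scaleE (K : comNzRingType) (A : algType K) (r : K) m n
    (M : 'M[A]_(m, n)) :
  map_mx (fun y => r *: y) M = r%:A *: M.
Proof. by apply/matrixP => i j; rewrite !mxE mulr_algl. Qed.

Lemma scale_col4 (A : nzRingType) (x a b c d : A) :
  x *: col4 a b c d = col4 (x * a) (x * b) (x * c) (x * d).
Proof. by rewrite /col4 !scale_col_mx !scale_scalar_mx. Qed.

Lemma map_col4 (A B : nzRingType) (f : {rmorphism A -> B}) (a b c d : A) :
  map_mx f (col4 a b c d) = col4 (f a) (f b) (f c) (f d).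
Proof. by rewrite /col4 !map_col_mx !map_scalar_mx. Qed.

Lemma row4_mul (K : comNzRingType) n (u v w t : 'cV[K]_n) (a b c d : K) :
  row_mx (row_mx u v) (row_mx w t) *m col4 a b c d
  = a *: u + b *: v + (c *: w + d *: t).
Proof. by rewrite /col4 !mul_row_col !mul_mx_scalar. Qed.

(* The eigenvector computations are done over an abstract algebra: over the
   concrete quotient, rewriting with laws such as [mul0r] unfolds the quotient
   construction and does not terminate in practice. *)
Section BlockEigencol.

Variables (K : comNzRingType) (A : algType K).
Implicit Types (x : K) (a b c d : A) (N M : 'M[A]_(1 + 1)).

Local Notation emb := (map_mx (in_alg A)).

(** The lower half of the column vanishes, so only the left block column acts. Zero entries are kept
    as [0%:M], as in [mx22], so that [spinL30] matches by unfolding. *)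
Lemma diag_block_mul a d (x y : A) N M :
  block_mx (block_mx a%:M 0%:M 0%:M d%:M) N 0 M *m col4 x y 0 0
  = col4 (a * x) (d * y) 0 0.
Proof.
rewrite /col4 mul_block_col block22_mul !mul0mx !raddf0 col_mx0.
by rewrite !mulmx0 !mul0r !addr0 add0r.
Qed.

Lemma triu_block_mul r a b d (x : A) N M :
  block_mx (map_mx (fun y => r *: y) (block_mx a%:M b%:M 0%:M d%:M)) N 0 M
    *m col4 x 0 0 0
  = col4 (r *: a * x) 0 0 0.
Proof.
rewrite map_scaleE /col4 mul_block_col -scalemxAl block22_mul !raddf0 col_mx0.
rewrite !mulmx0 mul0mx !mulr0 mul0r !addr0 scale_col_mx scale_scalar_mx.
by rewrite mulr_algl scalerAl raddf0 scaler0.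
Qed.

(** Both halves of the column start with 0, which kills the first column of each block; one product
    covers $e_{-+}$ and $e_{++}$. *)
Lemma tril_block_mul r s a c d (y w : A) :
  block_mx (map_mx (fun y => r *: y) (block_mx a%:M 0%:M c%:M d%:M)) 0 0
    (map_mx (fun y => s *: y) (block_mx a%:M 0%:M c%:M d%:M)) *m col4 0 y 0 w
  = col4 0 (r *: d * y) 0 (s *: d * w).
Proof.
rewrite !map_scaleE /col4 mul_block_col -!scalemxAl !block22_mul !mul0mx.
rewrite !mulr0 !mul0r !add0r addr0 !scale_col_mx !scale_scalar_mx.
by rewrite !mulr0 !mulr_algl !scalerAl.
Qed.

Lemma diag_block_eigen0 a d N M x :
  block_mx (block_mx a%:M 0%:M 0%:M d%:M) N 0 M *m emb (col4 x 0 0 0)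
  = a *: emb (col4 x 0 0 0).
Proof.
by rewrite map_col4 !(rmorph0 (in_alg A)) diag_block_mul scale_col4 !mulr0.
Qed.

Lemma diag_block_eigen1 a d N M x :
  block_mx (block_mx a%:M 0%:M 0%:M d%:M) N 0 M *m emb (col4 0 x 0 0)
  = d *: emb (col4 0 x 0 0).
Proof.
by rewrite map_col4 !(rmorph0 (in_alg A)) diag_block_mul scale_col4 !mulr0.
Qed.

Lemma triu_block_eigen0 r a b d N M x :
  block_mx (map_mx (fun y => r *: y) (block_mx a%:M b%:M 0%:M d%:M)) N 0 M
    *m emb (col4 x 0 0 0)
  = (r *: a) *: emb (col4 x 0 0 0).
Proof.
by rewrite map_col4 !(rmorph0 (in_alg A)) triu_block_mul scale_col4 !mulr0.
Qed.

Lemma tril_block_eigen1 r s a c d x :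
  block_mx (map_mx (fun y => r *: y) (block_mx a%:M 0%:M c%:M d%:M)) 0 0
    (map_mx (fun y => s *: y) (block_mx a%:M 0%:M c%:M d%:M))
    *m emb (col4 0 x 0 0)
  = (r *: d) *: emb (col4 0 x 0 0).
Proof.
by rewrite map_col4 !(rmorph0 (in_alg A)) tril_block_mul scale_col4 !mulr0.
Qed.

Lemma tril_block_eigen3 r s a c d x :
  block_mx (map_mx (fun y => r *: y) (block_mx a%:M 0%:M c%:M d%:M)) 0 0
    (map_mx (fun y => s *: y) (block_mx a%:M 0%:M c%:M d%:M))
    *m emb (col4 0 0 0 x)
  = (s *: d) *: emb (col4 0 0 0 x).
Proof.
by rewrite map_col4 !(rmorph0 (in_alg A)) tril_block_mul scale_col4 !mulr0.
Qed.

End BlockEigencol.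

(* Satisfied by columns with complex entries; elements of the algebra then move
   across matrices acting on them. *)
Definition scalar_col {A : nzRingType} {n} (v : 'cV[A]_n) :=
  forall a : A, v *m a%:M = a *: v.

(** Passage from $L$ to $\Lambda$: for [f] of degree 1, [r] will be $q$. *)
Lemma map_scale_eigencol (K : comNzRingType) (A : algType K) n (M : 'M[A]_n)
    (v : 'cV_n) (f : A) (r s : K) :
    M *m v = (s *: f) *: v ->
  map_mx (fun y => r *: y) M *m v = ((r * s) *: f) *: v.
Proof.
by rewrite map_scaleE -scalemxAl => ->; rewrite scalerA mulr_algl scalerA.
Qed.

(** * Twisted derivations on powers and ordered monomials *)

Section TwistedDerivation.

Variables (K : comNzRingType) (A : algType K) (n : nat).
Variables (Lam : A -> 'M[A]_n) (nabla : A -> 'cV[A]_n).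
Hypothesis Lam1 : Lam 1 = 1%:M.
Hypothesis LamM : forall f g, Lam (f * g) = Lam f *m Lam g.
Hypothesis nabla1 : nabla 1 = 0.
Hypothesis nablaM : forall f g,
  nabla (f * g) = nabla f *m g%:M + Lam f *m nabla g.

(** The factor [f] produced by one application of [Lam f] is moved to the right of [v], so the
    remaining power again acts on [v] itself. *)
Lemma twist_expr_eigencol (f : A) (c : K) (v : 'cV[A]_n) k :
    scalar_col v -> Lam f *m v = (c *: f) *: v ->
  Lam (f ^+ k) *m v = (c ^+ k *: f ^+ k) *: v.
Proof.
move=> sv fv; elim: k => [|k IHk].
  by rewrite !expr0 Lam1 mul1mx !scale1r.
rewrite exprSr LamM -mulmxA fv -sv mulmxA IHk -scalemxAl sv scalerA.
by rewrite -scalerAl -scalerAr scalerA -!exprSr.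
Qed.

(** [m k] is $1 + c + \dots + c^{k-1}$; for $c = q^2$ it becomes $(k)_{q^2}$. *)
Variables (c : K) (m : nat -> K).
Hypothesis m0 : m 0%N = 0.
Hypothesis mS : forall k, m k.+1 = m k + c ^+ k.

Lemma twisted_derivation_expr (f : A) k :
    scalar_col (nabla f) -> Lam f *m nabla f = (c *: f) *: nabla f ->
  nabla (f ^+ k) = (m k *: f ^+ k.-1) *: nabla f.
Proof.
move=> sf ff; elim: k => [|k IHk]; first by rewrite expr0 nabla1 m0 !scale0r.
rewrite exprSr nablaM IHk -scalemxAl sf (twist_expr_eigencol _ _ _ _ sf ff).
rewrite scalerA -scalerDl -scalerAl mS; congr (_ *: _); rewrite scalerDl.
(* At [k = 0], [f ^+ k.-1 * f] is [f] rather than [1], but its coefficient [m 0] is 0. *)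
by case: k {IHk} => [|k]; [rewrite m0 !scale0r|rewrite -exprSr].
Qed.

Lemma twisted_derivation_monomial (f g : A) k l :
    scalar_col (nabla f) -> Lam f *m nabla f = (c *: f) *: nabla f ->
    scalar_col (nabla g) -> Lam g *m nabla g = (c *: g) *: nabla g ->
    Lam f *m nabla g = f *: nabla g ->
  nabla (f ^+ k * g ^+ l)
  = (m k *: (f ^+ k.-1 * g ^+ l)) *: nabla f
    + (m l *: (f ^+ k * g ^+ l.-1)) *: nabla g.
Proof.
move=> sf ff sg gg fg; rewrite nablaM !twisted_derivation_expr // -scalemxAl sf.
(* With $g^{l-1}$ moved to the right of [nabla g], the power lemma with constant 1 puts $f^k$ on its
   left; moving $g^{l-1}$ back yields the ordered product without commuting [f] and [g]. *)
rewrite scalerA -scalerAl -sg mulmxA (twist_expr_eigencol f 1) ?scale1r //.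
by rewrite expr1n scale1r -scalemxAl sg scalerA -scalerAr.
Qed.

Hypothesis nabla_sum : forall (I : Type) (r : seq I) (F : I -> A),
  nabla (\sum_(i <- r) F i) = \sum_(i <- r) nabla (F i).
Hypothesis nablaZ : forall (x : K) f, nabla (x *: f) = x%:A *: nabla f.

Lemma twisted_derivation_ordered (f g : A) I (r : seq I) (F : I -> K)
    (k l : I -> nat) :
    scalar_col (nabla f) -> Lam f *m nabla f = (c *: f) *: nabla f ->
    scalar_col (nabla g) -> Lam g *m nabla g = (c *: g) *: nabla g ->
    Lam f *m nabla g = f *: nabla g ->
  nabla (\sum_(i <- r) F i *: (f ^+ k i * g ^+ l i))
  = (\sum_(i <- r) (F i * m (k i)) *: (f ^+ (k i).-1 * g ^+ l i)) *: nabla f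
    + (\sum_(i <- r) (F i * m (l i)) *: (f ^+ k i * g ^+ (l i).-1)) *: nabla g.
Proof.
move=> sf ff sg gg fg; rewrite nabla_sum !scaler_suml -big_split /=.
apply: eq_bigr => i _; rewrite nablaZ twisted_derivation_monomial // scalerDr.
by rewrite !scalerA !mulr_algl !scalerA.
Qed.

End TwistedDerivation.

(** * Quantum Minkowski space: $q$-numbers and the spinor basis *)

Section JacksonGradient.

Variables (R : realType) (q : R).

Local Notation X := (minkX q).

Lemma lambda_neq0 : 0 < q -> q != 1 -> lambda q != 0.
Proof.
move=> q_gt0 q_neq1; rewrite /lambda subr_eq0; apply: contra q_neq1 => /eqP qV.
have : q ^+ 2 == 1 by rewrite expr2 {2}qV divff // gt_eqF.
by rewrite sqrp_eq1 // ltW.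
Qed.

Lemma sqrt_qnum2_neq0 : 0 < q -> q != 1 -> Num.sqrt (qnum q 2) != 0.
Proof.
move=> q_gt0 q_neq1; have l0 := lambda_neq0 q_gt0 q_neq1.
suff -> : qnum q 2 = q + q^-1 by rewrite gt_eqF // sqrtr_gt0 addr_gt0 ?invr_gt0.
by rewrite /qnum -exprVn subr_sqr mulrC mulKf.
Qed.

Lemma qnum2_recr n :
  0 < q -> q != 1 -> qnum2 q n.+1 = qnum2 q n + (q ^+ 2) ^+ n.
Proof.
move=> q_gt0 q_neq1; have q2 : q ^+ 2 - 1 != 0.
  by rewrite subr_eq0 sqrp_eq1 // ltW.
by rewrite /qnum2 !exprM exprS; field.
Qed.

Lemma qnum2_0 : qnum2 q 0 = 0.
Proof. by rewrite /qnum2 muln0 expr0 subrr mul0r. Qed.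

Lemma spinor_basis_mul (a b c d : R[i]) :
  spinor_basis q *m col4 a b c d =
    a *: ((Num.sqrt (qnum q 2))%:C%C *: ebasis R[i] im)
    + b *: ((Num.sqrt q)%:C%C *: (ebasis R[i] i3 - ebasis R[i] i0))
    + (c *: ((Num.sqrt q)^-1%:C%C *: ebasis R[i] i3
             + (Num.sqrt q ^+ 3)%:C%C *: ebasis R[i] i0)
       + d *: ((Num.sqrt (qnum q 2))%:C%C *: ebasis R[i] ip)).
Proof. exact: row4_mul. Qed.

(** Let a row [v] kill all four columns: $e_{--}$ and $e_{++}$ give $v_- = v_+ = 0$, $e_{-+}$ gives
    $v_3 = v_0$, and $e_{+-}$ then leaves $(q^{-1/2} + q^{3/2}) v_0 = 0$. *)
Lemma spinor_basis_unit : 0 < q -> q != 1 ->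
  (spinor_basis q : 'M[R[i]]_4) \in unitmx.
Proof.
move=> q_gt0 q_neq1.
have s20 := sqrt_qnum2_neq0 q_gt0 q_neq1.
have sq0 : Num.sqrt q != 0 by rewrite gt_eqF // sqrtr_gt0.
have q21 : (Num.sqrt q)^-1 + Num.sqrt q ^+ 3 != 0.
  by rewrite gt_eqF // addr_gt0 ?exprn_gt0 ?invr_gt0 // sqrtr_gt0.
rewrite -row_free_unit -kermx_eq0; apply/rowV0P => v /sub_kermxP vP.
pose phi (u : 'cV_4) := (v *m u) 0 0.
have phiD u w : phi (u + w) = phi u + phi w by rewrite /phi mulmxDr mxE.
have phiB u w : phi (u - w) = phi u - phi w by rewrite /phi mulmxBr !mxE.
have phiZ c u : phi (c *: u) = c * phi u by rewrite /phi -scalemxAr mxE.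
have phiE i : phi (ebasis R[i] i) = v 0 i by rewrite /phi -colE mxE.
have C0 (x : R) (y : R[i]) : x != 0 -> x%:C%C * y = 0 -> y = 0.
  by move=> x0 /eqP; rewrite mulf_eq0 fmorph_eq0 (negPf x0) => /eqP.
have H a b c d : a * ((Num.sqrt (qnum q 2))%:C%C * v 0 im)
    + b * ((Num.sqrt q)%:C%C * (v 0 i3 - v 0 i0))
    + (c * ((Num.sqrt q)^-1%:C%C * v 0 i3 + (Num.sqrt q ^+ 3)%:C%C * v 0 i0)
       + d * ((Num.sqrt (qnum q 2))%:C%C * v 0 ip)) = 0.
  rewrite -!phiE -phiB -!phiZ -!phiD -!phiZ -!phiD -spinor_basis_mul /phi.
  move: (col4 _ _ _ _); move: vP; rewrite -[(1 + 1 + (1 + 1))%N]/4%N.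
  by move: (spinor_basis q : 'M_4) => P vP u; rewrite mulmxA vP mul0mx mxE.
have vm : v 0 im = 0.
  by have := H 1 0 0 0; rewrite mul1r !mul0r !addr0 => /C0 ->.
have vp : v 0 ip = 0.
  by have := H 0 0 0 1; rewrite mul1r !mul0r !add0r => /C0 ->.
have v30 : v 0 i3 = v 0 i0.
  by have := H 0 1 0 0; rewrite mul1r !mul0r !addr0 add0r => /C0/subr0_eq ->.
have v0 : v 0 i0 = 0.
  have := H 0 0 1 0; rewrite mul1r !mul0r !addr0 v30 -mulrDl -rmorphD add0r.
  by move=> /C0 ->.
apply/rowP => i; rewrite mxE.
by case: i => [[|[|[|[|//]]]] ilt];
  [rewrite -v0|rewrite -vm|rewrite -vp|rewrite -v0 -v30];
  congr (v 0 _); apply: val_inj.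
Qed.

Lemma scalar_col_map n (w : 'cV[R[i]]_n) :
  scalar_col (map_mx (in_alg X) w).
Proof.
move=> a; apply/matrixP => i j; rewrite !mxE big_ord1 !mxE.
by rewrite !ord1 eqxx mulr1n mulr_algl mulr_algr.
Qed.

Lemma from_spinor_eigencol (M : 'M[X]_((1 + 1) + (1 + 1)))
    (w : 'cV[R[i]]_((1 + 1) + (1 + 1))) (a : X) :
    0 < q -> q != 1 ->
    M *m map_mx (in_alg X) w = a *: map_mx (in_alg X) w ->
  from_spinor M *m map_mx (in_alg X) (spinor_basis q *m w)
    = a *: map_mx (in_alg X) (spinor_basis q *m w).
Proof.
move=> q_gt0 q_neq1; apply: (@conj_mx_eigencol _ _ _ 4).
  exact: spinor_basis_unit.
by move=> m u; apply: scalar_col_map.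
Qed.

Lemma homogeneous_xgen i : homogeneous 1 (xgen q i).
Proof.
exists (fgen R[i] i); split=> // m.
by rewrite /fgen msuppU oner_eq0 inE => /eqP ->; rewrite fdegU.
Qed.

Lemma homogeneous_x30 : homogeneous 1 (x30 q).
Proof.
exists (fgen R[i] i3 - fgen R[i] i0); split.
  by rewrite /x30 /x3 /x0 /xgen /piX rmorphB.
move=> m /(fsubsetP (msuppB_le _ _)); rewrite !inE.
by rewrite /fgen !msuppU oner_eq0 !inE => /orP[] /eqP ->; rewrite fdegU.
Qed.

Local Notation "r *:r x" := ((r)%:C%C *: x) (at level 40).

Hypotheses (q_gt0 : 0 < q) (q_neq1 : q != 1).

(** This and the next two lemmas invert the normalisations of $e_{--}$, $e_{-+}$ and $e_{++}$. *)
Lemma spinor_basis_em :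
  spinor_basis q *m col4 ((Num.sqrt (qnum q 2))^-1)%:C%C 0 0 0 = ebasis R[i] im.
Proof.
rewrite spinor_basis_mul !scale0r !addr0 scalerA -rmorphM mulVf.
  by rewrite rmorph1 scale1r.
exact: sqrt_qnum2_neq0.
Qed.

Lemma spinor_basis_e30 :
  spinor_basis q *m col4 0 ((Num.sqrt q)^-1)%:C%C 0 0
  = ebasis R[i] i3 - ebasis R[i] i0.
Proof.
rewrite spinor_basis_mul !scale0r !addr0 add0r scalerA -rmorphM mulVf.
  by rewrite rmorph1 scale1r.
by rewrite gt_eqF // sqrtr_gt0.
Qed.

Lemma spinor_basis_ep :
  spinor_basis q *m col4 0 0 0 ((Num.sqrt (qnum q 2))^-1)%:C%C = ebasis R[i] ip.
Proof.
rewrite spinor_basis_mul !scale0r !add0r scalerA -rmorphM mulVf.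
  by rewrite rmorph1 scale1r.
exact: sqrt_qnum2_neq0.
Qed.

Local Notation emb := (map_mx (in_alg X)).

(** The factor $q$ by which $\Lambda$ differs from $L$ in degree 1 cancels an eigenvalue factor
    $q^{-1}$, as here, and turns a factor $q$ into $q^2$. *)
Lemma spinL30_em :
  from_spinor (spinL30 q) *m emb (ebasis R[i] im)
  = (q^-1 *:r x30 q) *: emb (ebasis R[i] im).
Proof.
rewrite -spinor_basis_em; apply: from_spinor_eigencol => //.
exact: diag_block_eigen0.
Qed.

Lemma spinL30_e30 :
  from_spinor (spinL30 q) *m emb (ebasis R[i] i3 - ebasis R[i] i0)
  = (q *:r x30 q) *: emb (ebasis R[i] i3 - ebasis R[i] i0).
Proof.
rewrite -spinor_basis_e30; apply: from_spinor_eigencol => //.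
exact: diag_block_eigen1.
Qed.

Lemma spinLm_em :
  from_spinor (spinLm q) *m emb (ebasis R[i] im)
  = (q *:r xm q) *: emb (ebasis R[i] im).
Proof.
rewrite -spinor_basis_em; apply: from_spinor_eigencol => //.
exact: triu_block_eigen0.
Qed.

Lemma spinLp_e30 :
  from_spinor (spinLp q) *m emb (ebasis R[i] i3 - ebasis R[i] i0)
  = (q^-1 *:r xp q) *: emb (ebasis R[i] i3 - ebasis R[i] i0).
Proof.
rewrite -spinor_basis_e30; apply: from_spinor_eigencol => //.
exact: tril_block_eigen1.
Qed.

Lemma spinLp_ep :
  from_spinor (spinLp q) *m emb (ebasis R[i] ip)
  = (q *:r xp q) *: emb (ebasis R[i] ip).
Proof.
rewrite -spinor_basis_ep; apply: from_spinor_eigencol => //.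
exact: tril_block_eigen3.
Qed.

(** * The gradient of ordered polynomials *)

Variables (L Lam : homM4 q) (nabla : linV4 q).
Hypotheses (L_def : is_L L) (Lam_def : is_Lambda L Lam).
Hypothesis nabla_def : is_gradient Lam nabla.

Lemma Lam_eigencol (f : X) (M : 'M[X]_4) (r : R) (v : 'cV[X]_4) :
    homogeneous 1 f -> L f = M -> M *m v = (r *:r f) *: v ->
  Lam f *m v = ((q * r) *:r f) *: v.
Proof.
move=> /Lam_def -> -> Mv; rewrite expr1 [(q * r)%:C%C]rmorphM.
exact: map_scale_eigencol.
Qed.

Lemma nabla_ordeval (a b : X) (f : ordpoly R 2) :
    scalar_col (nabla a) -> Lam a *m nabla a = ((q ^+ 2) *:r a) *: nabla a ->
    scalar_col (nabla b) -> Lam b *m nabla b = ((q ^+ 2) *:r b) *: nabla b ->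
    Lam a *m nabla b = a *: nabla b ->
  let y := [tuple a; b] in
  nabla (ordeval y f)
  = jackson y ord0 f *: nabla a + jackson y ord_max f *: nabla b.
Proof.
move=> sa aa sb bb ab y; have [n1 _ nM] := nabla_def.
have ordmonE k : ordmon y k = a ^+ k ord0 * b ^+ k ord_max.
  rewrite /ordmon big_ord_recl big_ord1; congr (_ ^+ _ * _ ^+ k _).
  by apply: val_inj.
transitivity (nabla (\sum_(k <- msupp f)
    f@_k *: (a ^+ k ord0 * b ^+ k ord_max))).
  apply: (congr1 nabla); apply: eq_bigr => k _.
  exact: (congr1 (fun z => f@_k *: z) (ordmonE k)).
have m0 : (qnum2 q 0)%:C%C = 0 by rewrite qnum2_0.
have mS k : (qnum2 q k.+1)%:C%C = (qnum2 q k)%:C%C + (q ^+ 2)%:C%C ^+ k.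
  by rewrite qnum2_recr // rmorphD rmorphXn.
have nS I (r : seq I) (F : I -> X) :
    nabla (\sum_(i <- r) F i) = \sum_(i <- r) nabla (F i).
  exact: raddf_sum.
have nZ (x : R[i]) g : nabla (x *: g) = x%:A *: nabla g.
  exact: linearZ_LR.
have j0 : jackson y ord0 f = \sum_(k <- msupp f)
    (f@_k * (qnum2 q (k ord0))%:C%C) *: (a ^+ (k ord0).-1 * b ^+ k ord_max).
  apply: eq_bigr => k _; apply: (congr1 (fun z => _ *: z)).
  (* The boolean [i == a] computes to 1 at the differentiated index and to 0 at the other. *)
  by apply: etrans (ordmonE _) _; rewrite !ffunE subn0 subn1.
have j1 : jackson y ord_max f = \sum_(k <- msupp f)
    (f@_k * (qnum2 q (k ord_max))%:C%C) *: (a ^+ k ord0 * b ^+ (k ord_max).-1).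
  apply: eq_bigr => k _; apply: (congr1 (fun z => _ *: z)).
  by apply: etrans (ordmonE _) _; rewrite !ffunE subn0 subn1.
rewrite j0 j1.
exact: (twisted_derivation_ordered _ _ _ Lam nabla (rmorph1 Lam)
  (rmorphM Lam) n1 nM _ _ m0 mS nS nZ _ _ _ (msupp f) (fun k => f@_k)
  (fun k => k ord0) (fun k => k ord_max) sa aa sb bb ab).
Qed.

Lemma nabla_xgen i : nabla (xgen q i) = emb (ebasis R[i] i).
Proof. by have [_ -> _] := nabla_def; rewrite /ebasis map_delta_mx. Qed.

Lemma nabla_x30 : nabla (x30 q) = emb (ebasis R[i] i3 - ebasis R[i] i0).
Proof. by rewrite map_mxB -!nabla_xgen; apply: raddfB. Qed.

Lemma scale_real1 (r : R) (f : X) : r = 1 -> r *:r f = f.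
Proof. by move=> ->; apply: scale1r. Qed.

(** [x30] comes first because $e_{--}$ is an eigenvector of $L_{x_{3\setminus0}}$, whereas $L_{x_-}$
    gives $e_{-+}$ an extra component along $e_{--}$. *)
Lemma nabla_x30_xm (f : ordpoly R 2) :
  let y := [tuple x30 q; xm q] in
  nabla (ordeval y f)
  = jackson y ord0 f *: nabla (x30 q) + jackson y ord_max f *: nabla (xm q).
Proof.
have [_ Lm _ L30] := L_def.
apply: nabla_ordeval; rewrite ?nabla_x30 ?[nabla (xm q)]nabla_xgen.
- exact: scalar_col_map.
(* The factor obtained is [q * q], convertible to [q ^+ 2]. *)
- exact: Lam_eigencol homogeneous_x30 L30 spinL30_e30.
- exact: scalar_col_map.
- exact: Lam_eigencol (homogeneous_xgen im) Lm spinLm_em.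
- rewrite (Lam_eigencol _ _ _ _ homogeneous_x30 L30 spinL30_em).
  by rewrite scale_real1 // mulfV // gt_eqF.
Qed.

(** [xp] comes first because $e_{-+}$ is an eigenvector of $L_{x_+}$, whereas $L_{x_{3\setminus0}}$
    gives $e_{++}$ an extra component along $e_{-+}$. *)
Lemma nabla_xp_x30 (f : ordpoly R 2) :
  let y := [tuple xp q; x30 q] in
  nabla (ordeval y f)
  = jackson y ord0 f *: nabla (xp q) + jackson y ord_max f *: nabla (x30 q).
Proof.
have [_ _ Lp L30] := L_def.
apply: nabla_ordeval; rewrite ?nabla_x30 ?[nabla (xp q)]nabla_xgen.
- exact: scalar_col_map.
- exact: Lam_eigencol (homogeneous_xgen ip) Lp spinLp_ep.
- exact: scalar_col_map.
- exact: Lam_eigencol homogeneous_x30 L30 spinL30_e30.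
- rewrite (Lam_eigencol _ _ _ _ (homogeneous_xgen ip) Lp spinLp_e30).
  by rewrite scale_real1 // mulfV // gt_eqF.
Qed.

End JacksonGradient.

Theorem proposition1 (R : realType) (q : R) (q_gt0 : 0 < q) (q_neq1 : q != 1)
    (L Lam : homM4 q) (nabla : linV4 q)
    (L_def : is_L L) (Lam_def : is_Lambda L Lam)
    (nabla_def : is_gradient Lam nabla) :
  (forall f : ordpoly R 2,
     let y := [tuple x30 q; xm q] in
     nabla (ordeval y f)
     = jackson y ord0 f *: nabla (x30 q) + jackson y ord_max f *: nabla (xm q))
  /\
  (forall f : ordpoly R 2,
     let y := [tuple xp q; x30 q] in
     nabla (ordeval y f)
     = jackson y ord0 f *: nabla (xp q) + jackson y ord_max f *: nabla (x30 q)).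
Proof.
by split=> f; [apply: nabla_x30_xm L_def Lam_def nabla_def f
              |apply: nabla_xp_x30 L_def Lam_def nabla_def f].
Qed.
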